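(* Let $l$ be a prime with $l\equiv 13,17,19,23 \pmod{24}$. Then for every integer $n\geq 0$ and every integer $j$ with $1\leq j\leq l-1$, $$b_4\left(3l(ln+j)+\frac{l^{2}-1}{8}\right)\equiv 0 \pmod 3\quad\text{and}\quad b_4\left(3l(ln+j)+\frac{9l^{2}-1}{8}\right)\equiv 0 \pmod 3.$$
   Context: $b_4(n)$ denotes the number of partitions of $n$ in which no part is a multiple of $4$, with $b_4(0)=1$; equivalently $\sum_{n\geq 0} b_4(n)q^n=\prod_{n\geq 1}\frac{1-q^{4n}}{1-q^n}$. *)

(* Defs.v *)
From mathcomp Require Import all_boot.

Set Implicit Arguments.
Unset Strict Implicit.
Unset Printing Implicit Defensive.

(* A partition of n, i.e. a finite multiset of positive integers with sum n,
   is given by its multiplicity function: the part i.+1 occurs m i times.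
   Parts and multiplicities of a partition of n are at most n. *)
Definition partitions (n : nat) : {set {ffun 'I_n -> 'I_n.+1}} :=
  [set m : {ffun 'I_n -> 'I_n.+1} | \sum_(i < n) i.+1 * m i == n].

Definition is_part (n : nat) (m : {ffun 'I_n -> 'I_n.+1}) (k : nat) : bool :=
  [exists i : 'I_n, (i.+1 == k) && (0 < m i)].

Definition b4 (n : nat) : nat :=
  #|[set m in partitions n |
      [forall k : 'I_n.+1, is_part m k ==> ~~ (4 %| k)]]|.

(* Main.v *)
(** Write [f_k = prod_i (1 - q^(k i))], [phi(q) = sum_(s in Z) q^(s^2)] and
    [psi(q) = sum_(k >= 0) q^(k (k+1) / 2)], so that [F = f_4 / f_1] generates [b4]
    and [phi(-q) = f_1^2 / f_2], [psi(q) = f_2^2 / f_1] by Gauss.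
    Multiplication by a cube root of unity acts freely on the nonzero Eisenstein
    integers of given norm, hence [sum_(a, b) q^(a^2 + a b + b^2) = 1] modulo 3;
    splitting by the parity of [b], this reads
      [phi(q) phi(q^3) + q psi(q^2) psi(q^6) = 1]  modulo 3.
    Multiply this identity and its image under [q -> -q] by [F].  Modulo 3,
    [f_k^3] is a series in [q^3], and one finds
      [F = psi(-q) phi(-q^3) - q psi(q) A(q^3)],
      [F = - psi(-q) phi(-q^3) - phi(-q^2) B(q^3)]
    for some series [A] and [B].  As [q psi(q)] has no exponent divisible by 3 and
    [phi(-q^2)] none congruent to 1 modulo 3, [b4 N] is, up to sign, the coefficient
    of [q^N] in [psi(-q) phi(-q^3)] whenever [N] is 0 or 1 modulo 3.  A nonzero
    coefficient requires [8 N + 1 = x^2 + 6 y^2], which is impossible when a prime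
    inert in Q(sqrt -6) divides [8 N + 1] exactly once.  Power series are
    represented by polynomials modulo ['X^(N+1)]. *)

Require Import Defs.
From mathcomp Require Import all_boot all_order all_algebra zify ring.

Set Implicit Arguments.
Unset Strict Implicit.
Unset Printing Implicit Defensive.
Import GRing.Theory Num.Theory.
Local Open Scope ring_scope.

(** * Theta functions and Gauss's product formulas *)

Section Gauss.
Variable R : comNzRingType.
Implicit Types x : R.

(* Truncations of the q-series: the identities between them hold modulo
   [x ^+ L.+1], for [psi] only if [L > 0] since [psi 0 x = 0]. *)
Definition euler L x : R := \prod_(i < L) (1 - x ^+ i.+1).
Definition eulerodd L x : R := \prod_(i < L) (1 - x ^+ i.*2.+1).
Definition phi L x : R := 1 + (\sum_(i < L) x ^+ (i.+1 ^ 2)) *+ 2.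
Definition psi L x : R := \sum_(i < L.*2) x ^+ 'C(i.+1, 2).

(* Shanks's finite forms of Gauss's identities: every correction term is divisible
   by [x ^+ n.+1]. *)
Let shanks_phi_term n x t : R := (-1) ^+ t.+1 * x ^+ (t.+1 * n.+1) *
  (\prod_(t.+1 <= i < n) (1 - x ^+ i.+1)) * \prod_(i < t) (1 + x ^+ i.+1).

Lemma shanks_phi n x :
  (\prod_(i < n) (1 + x ^+ i.+1)) * phi n (- x) =
  euler n x + (\sum_(t < n) shanks_phi_term n x t) *+ 2.
Proof.
elim: n => [|n IH]; first by rewrite /phi /euler !big_ord0 mul0rn mul1r.
set y := x ^+ n.+1.
pose E t := \prod_(i < t) (1 + x ^+ i.+1).
(* Chosen so that [1 + y] times the [t]-th correction term at level [n], minus the one at level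
   [n + 1], is [c t - c (t + 1)]. The factor [1 + y] is what the product on the left gains. *)
pose c t : R := (-1) ^+ t.+1 * y ^+ t.+1 *
  (\prod_(t <= i < n) (1 - x ^+ i.+1)) * E t.
have phiS : phi n.+1 (- x) = phi n (- x) + ((-1) ^+ n.+1 * y ^+ n.+1) *+ 2.
  rewrite /phi big_ord_recr /= mulrnDl addrA; congr (_ + _ *+ 2).
  rewrite [LHS]exprNn /y -exprM mulnn; congr (_ * _).
  by rewrite -[LHS]signr_odd -[RHS]signr_odd oddX.
have tele : \sum_(t < n) ((1 + y) * shanks_phi_term n x t -
                          shanks_phi_term n.+1 x t) = c 0 - c n.
  rewrite -(big_mkord xpredT (fun t => (1 + y) * shanks_phi_term n x t -
                          shanks_phi_term n.+1 x t)) -opprB.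
  rewrite -(telescope_sumr (fun t => c t) (leq0n n)) -sumrN.
  apply: eq_big_nat => t /andP[_ lt_tn]; rewrite /shanks_phi_term /c /E.
  rewrite big_nat_recr //= (big_ltn lt_tn) big_ord_recr /=.
  have -> : x ^+ (t.+1 * n.+1) = y ^+ t.+1 by rewrite -exprM mulnC.
  have -> : x ^+ (t.+1 * n.+2) = y ^+ t.+1 * x ^+ t.+1.
    by rewrite -exprM -exprD; congr (x ^+ _); lia.
  by rewrite -/y !(exprS _ t.+1); ring.
have last : shanks_phi_term n.+1 x n = c n * y.
  rewrite /shanks_phi_term /c !big_geq // !mulr1 -/(E n).
  have -> : x ^+ (n.+1 * n.+2) = y ^+ n.+1 * y.
    by rewrite -exprM -exprD; congr (x ^+ _); lia.
  by ring.
rewrite phiS 2!big_ord_recr /= last /euler big_ord_recr /= -/y -/(euler n x).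
move: tele IH; rewrite sumrB -mulr_sumr -/(E n).
have -> : c 0 = - y * euler n x.
  by rewrite /c /E big_ord0 big_mkord -/(euler n x) !expr1; ring.
have -> : c n = (-1) ^+ n.+1 * y ^+ n.+1 * E n by rewrite /c big_geq // mulr1.
set S := \sum_(t < n) shanks_phi_term n x t.
set S' := \sum_(t < n) shanks_phi_term n.+1 x t; set z := _ * y ^+ _.
set p := phi _ _ => tele IH.
have -> : S' = (1 + y) * S - (- y * euler n x - z * E n) by rewrite -tele; ring.
transitivity ((1 + y) * (E n * p) + E n * (1 + y) * z *+ 2); first by ring.
by rewrite IH; ring.
Qed.

Let shanks_psi_term n x s : R := x ^+ (s * n.*2.+1) * eulerodd s x *
  \prod_(s <= i < n) (1 - x ^+ i.+1.*2).

Lemma shanks_psi n x :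
  eulerodd n x * psi n x = \sum_(s < n) shanks_psi_term n x s.
Proof.
elim: n => [|n IH]; first by rewrite /psi /eulerodd !big_ord0 mulr0.
set y := x ^+ n.*2.+1.
pose D s := eulerodd s x.
have DS s : D s.+1 = D s * (1 - x ^+ s.*2.+1) by rewrite /D /eulerodd big_ord_recr.
(* The same telescoping with [1 - y], the factor that [eulerodd] gains; [c 0] vanishes through
   [1 - x ^+ 0]. *)
pose c s : R := y ^+ s * D s * (1 - x ^+ s.*2) *
  (\prod_(s <= i < n) (1 - x ^+ i.+1.*2)).
(* The two new triangular exponents are [n (2 n + 1)] and [(n + 1) (2 n + 1)]. *)
have psiS : psi n.+1 x = psi n x + y ^+ n + y ^+ n.+1.
  rewrite /psi doubleS 2!big_ord_recr /=; congr (_ + _ + _).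
    by rewrite /y -exprM bin2 /= -doubleMr doubleK mulnC.
  by rewrite /y -exprM bin2 -[n.*2.+2]doubleS -doubleMl doubleK mulnC.
have tele : \sum_(s < n) ((1 - y) * shanks_psi_term n x s -
                          shanks_psi_term n.+1 x s) = c 0 - c n.
  rewrite -(big_mkord xpredT (fun s => (1 - y) * shanks_psi_term n x s -
                          shanks_psi_term n.+1 x s)) -[RHS]opprB.
  rewrite -(telescope_sumr (fun s => c s) (leq0n n)) -sumrN.
  apply: eq_big_nat => s /andP[_ lt_sn]; rewrite /shanks_psi_term /c DS -/(D s).
  rewrite big_nat_recr /=; last exact: ltnW.
  rewrite (big_ltn lt_sn).
  have -> : x ^+ n.+1.*2 = x * y by rewrite -exprS doubleS.
  have -> : x ^+ (s * n.*2.+1) = y ^+ s by rewrite -exprM mulnC.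
  have -> : x ^+ (s * n.+1.*2.+1) = y ^+ s * x ^+ s.*2.
    by rewrite -exprM -exprD; congr (x ^+ _); lia.
  have -> : x ^+ s.+1.*2 = x * x * x ^+ s.*2 by rewrite doubleS !exprS mulrA.
  by rewrite !exprS; ring.
have last : shanks_psi_term n.+1 x n = y ^+ n * x ^+ n.*2 * D n * (1 - x * y).
  rewrite /shanks_psi_term big_nat1 doubleS exprS -/y -/(D n).
  have -> : x ^+ (n * n.*2.+3) = y ^+ n * x ^+ n.*2.
    by rewrite -exprM -exprD; congr (x ^+ _); lia.
  by [].
rewrite psiS big_ord_recr /= last -/(D _) DS -/y.
move: tele IH; rewrite sumrB -mulr_sumr -/(D n).
have -> : c 0 = 0 by rewrite /c expr0 subrr mulr0 mul0r.
have -> : c n = y ^+ n * D n * (1 - x ^+ n.*2) by rewrite /c big_geq // mulr1.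
set S := \sum_(t < n) shanks_psi_term n x t.
set S' := \sum_(t < n) shanks_psi_term n.+1 x t.
set p := psi _ _ => tele IH.
have -> : S' = (1 - y) * S - (0 - y ^+ n * D n * (1 - x ^+ n.*2)).
  by rewrite -tele; ring.
transitivity ((1 - y) * (D n * p) + D n * (1 - y) * (y ^+ n + y ^+ n.+1)); first by ring.
rewrite IH exprS.
have -> : y = x * x ^+ n.*2 by rewrite -exprS.
by ring.
Qed.

End Gauss.

Lemma euler_sqr (R : comNzRingType) L (x : R) :
  euler L (x ^+ 2) = euler L x * \prod_(i < L) (1 + x ^+ i.+1).
Proof.
rewrite /euler -big_split; apply: eq_bigr => i _ /=.
by rewrite exprAC; ring.
Qed.

(** * Congruences modulo a power of the indeterminate *)

Section Congruences.
Variable K : fieldType.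
Implicit Types p q c d x : {poly K}.

Definition eqX M p q := 'X^M %| p - q.

Lemma eqX_refl M p : eqX M p p. Proof. by rewrite /eqX subrr dvdp0. Qed.

Lemma eqX_sym M p q : eqX M p q -> eqX M q p.
Proof. by rewrite /eqX -opprB dvdpNr. Qed.

Lemma eqX_trans M q p r : eqX M p q -> eqX M q r -> eqX M p r.
Proof.
rewrite /eqX => pq qr.
have -> : p - r = (p - q) + (q - r) by ring.
by rewrite dvdp_add.
Qed.

Lemma eqXM M p p' q q' : eqX M p p' -> eqX M q q' -> eqX M (p * q) (p' * q').
Proof.
rewrite /eqX => pp' qq'.
have -> : p * q - p' * q' = q * (p - p') + p' * (q - q') by ring.
by rewrite dvdp_add ?dvdp_mull.
Qed.

Lemma eqX_prod M (I : Type) (r : seq I) (P : pred I) (F G : I -> {poly K}) :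
  (forall i, P i -> eqX M (F i) (G i)) ->
  eqX M (\prod_(i <- r | P i) F i) (\prod_(i <- r | P i) G i).
Proof.
move=> FG; apply: (big_ind2 (eqX M)) => //; first exact: eqX_refl.
by move=> *; apply: eqXM.
Qed.

Lemma eqX_coef M p q i : eqX M p q -> (i < M)%N -> p`_i = q`_i.
Proof.
move=> /dvdpP[r /(congr1 (fun s : {poly K} => s`_i))].
by rewrite coefB coefMXn => /eqP H lt_iM; move: H; rewrite lt_iM subr_eq0 => /eqP.
Qed.

Lemma eqX_from_coef M (p q : {poly K}) :
  (forall i, (i < M)%N -> p`_i = q`_i) -> eqX M p q.
Proof.
move=> pq; rewrite /eqX -(poly_take_drop M (p - q)) addrC dvdp_addr ?dvdp_mull //.
rewrite (_ : take_poly M _ = 0) ?dvdp0 //; apply/polyP => i.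
by rewrite coef_take_poly coef0 coefB; case: ifP => // /pq ->; rewrite subrr.
Qed.

Lemma eqX_cancel M c p q : c`_0 != 0 -> eqX M (c * p) (c * q) -> eqX M p q.
Proof.
move=> c0; rewrite /eqX -mulrBr Gauss_dvdpr // coprimep_expl //.
by rewrite coprimep_sym -[X in coprimep _ X]subr0 coprimep_XsubC rootE horner_coef0.
Qed.

Lemma dvdX_exp M x e : 'X %| x -> (M <= e)%N -> 'X^M %| x ^+ e.
Proof.
move=> Xx le_Me; apply: (@dvdp_trans _ ('X^e)); last exact: dvdp_exp2r.
by rewrite dvdp_exp2l.
Qed.

Lemma euler_tail L x (P : pred nat) m : 'X %| x -> (L <= m)%N ->
  eqX L.+1 (\prod_(i < m | P i) (1 - x ^+ i.+1)) (\prod_(i < L | P i) (1 - x ^+ i.+1)).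
Proof.
move=> Xx /subnKC <-; move: (m - L)%N => k.
rewrite -!(big_mkord P (fun i => 1 - x ^+ i.+1)) (big_cat_nat (leq0n L)) ?leq_addr //=.
rewrite -[X in eqX _ _ X]mulr1; apply: eqXM; first exact: eqX_refl.
rewrite big_nat_cond; apply: (big_ind (fun p => eqX L.+1 p 1)); first exact: eqX_refl.
  by move=> p q p1 q1; rewrite -(mulr1 1); apply: eqXM.
move=> i /andP[/andP[le_Li _] _].
by rewrite /eqX addrC addKr dvdpNr dvdX_exp.
Qed.

Lemma euler_coef0 L x : 'X %| x -> (euler L x)`_0 != 0.
Proof.
rewrite -[X in X %| _]subr0 dvdp_XsubCl rootE => /eqP x0.
rewrite -horner_coef0 /euler horner_prod big1 ?oner_eq0 // => i _.
by rewrite !hornerE /= x0 expr0n /= subr0.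
Qed.

(** Even and odd exponents together give all exponents up to [2 L]; those beyond [L] are invisible
    at this precision. *)
Lemma euler_eulerodd L x : 'X %| x ->
  eqX L.+1 (euler L (x ^+ 2) * eulerodd L x) (euler L x).
Proof.
move=> Xx; have -> : euler L (x ^+ 2) * eulerodd L x = euler L.*2 x.
  elim: L => [|L IH]; first by rewrite /euler /eulerodd !big_ord0 mulr1.
  move: IH; rewrite /euler /eulerodd doubleS !big_ord_recr /= => <-.
  rewrite -exprM mul2n doubleS; ring.
by apply: (euler_tail xpredT) => //; rewrite -addnn leq_addr.
Qed.

(** This is Shanks's identity times [euler L x], by the factorization [euler_sqr]. *)
Lemma phi_euler L x : 'X %| x ->
  eqX L.+1 (phi L (- x) * euler L (x ^+ 2)) (euler L x ^+ 2).
Proof.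
move=> Xx; rewrite euler_sqr.
have := shanks_phi L x; set D := \prod_(i < L) _; set S := \sum_(t < L) _ => eqD.
have XS : ('X^(L.+1) : {poly K}) %| S.
  apply: (big_ind (fun p : {poly K} => 'X^_ %| p)) => [||t _]; [exact: dvdp0 | exact: dvdp_add |].
  rewrite -mulrA dvdp_mulr // dvdp_mull // dvdX_exp //.
  by rewrite mulSn leq_addr.
rewrite /eqX; have -> : phi L (- x) * (euler L x * D) - euler L x ^+ 2 =
   euler L x * (D * phi L (- x) - euler L x) by ring.
rewrite eqD addrC addKr dvdp_mull // mulr2n dvdp_add //.
Qed.

Lemma psi_euler L x : (0 < L)%N -> 'X %| x ->
  eqX L.+1 (psi L x * euler L x) (euler L (x ^+ 2) ^+ 2).
Proof.
move=> L0 Xx; set f2 := euler L (x ^+ 2).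
suff DS : eqX L.+1 (eulerodd L x * psi L x) f2.
  apply: (@eqX_trans _ (psi L x * (f2 * eulerodd L x))).
    by apply: eqXM; [exact: eqX_refl | apply/eqX_sym/euler_eulerodd].
  have -> : psi L x * (f2 * eulerodd L x) = f2 * (eulerodd L x * psi L x) by ring.
  by rewrite expr2; apply: eqXM DS; exact: eqX_refl.
(* Only the term [s = 0], present because [L > 0], survives: for [s >= 1] the exponent [s (2 L + 1)]
   exceeds [L]. *)
rewrite shanks_psi; case: L L0 @f2 => // L _ f2.
rewrite /eqX big_ord_recl /= mul0n expr0 mul1r big_mkord.
rewrite {1}/eulerodd big_ord0 mul1r.
have -> : \prod_(i < L.+1) (1 - x ^+ i.+1.*2) = f2.
  by apply: eq_bigr => i _; rewrite -exprM mul2n.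
rewrite addrC addKr; apply: (big_ind (fun p : {poly K} => 'X^_ %| p)) => [||s _].
- exact: dvdp0.
- exact: dvdp_add.
rewrite -mulrA dvdp_mulr // dvdX_exp //= mulSn -addnn; lia.
Qed.

(** Split each Euler product into even and odd exponents; the odd parts in [x] and [- x] multiply to
    the odd part in [x ^+ 2]. *)
Lemma eulerN L x : 'X %| x ->
  eqX L.+1 (euler L (- x) * euler L x * euler L (x ^+ 4)) (euler L (x ^+ 2) ^+ 3).
Proof.
move=> Xx.
have := @euler_eulerodd L (- x); rewrite dvdpNr sqrrN => /(_ Xx) e1.
have e2 := euler_eulerodd L Xx.
have := @euler_eulerodd L (x ^+ 2); rewrite -exprM dvdp_mulr // => /(_ isT) e3.
have DD : eulerodd L (- x) * eulerodd L x = eulerodd L (x ^+ 2).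
  rewrite /eulerodd -big_split; apply: eq_bigr => i _ /=.
  have -> : (- x) ^+ i.*2.+1 = - x ^+ i.*2.+1.
    by rewrite exprNn -signr_odd /= odd_double expr1 mulN1r.
  by rewrite exprAC; ring.
set f1 := euler L x in e2 *; set f2 := euler L (x ^+ 2) in e1 e2 e3 *.
set f4 := euler L (x ^+ 4) in e3 *.
apply: (@eqX_trans _ ((f2 * eulerodd L (- x)) * (f2 * eulerodd L x) * f4)).
  by apply/eqXM/eqX_refl/eqXM/eqX_sym/e2/eqX_sym.
have -> : f2 * eulerodd L (- x) * (f2 * eulerodd L x) * f4 =
  f2 ^+ 2 * (f4 * eulerodd L (x ^+ 2)) by rewrite -DD; ring.
by rewrite [X in eqX _ _ X]exprSr; apply: eqXM e3; exact: eqX_refl.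
Qed.

End Congruences.

(** * The generating function of [b4] *)

Section GeneratingFunction.
Variable K : fieldType.

(** Multiplicities range over ['I_n.+1] as in [partitions], so that expanding the product gives a
    sum over the same finite functions. *)
Definition gen4 n : {poly K} := \prod_(i < n) \sum_(m < n.+1)
  (if (4 %| i.+1)%N && (0 < m)%N then 0 else 'X^(i.+1 * m)).

Lemma coef_gen4 n : (gen4 n)`_n = (b4 n)%:R.
Proof.
rewrite /gen4 bigA_distr_bigA /= coef_sum /b4 -sum1_card natr_sum [RHS]big_mkcond /=.
apply: eq_bigr => m _; rewrite !inE.
have -> : [forall k : 'I_n.+1, is_part m k ==> ~~ (4 %| k)%N] =
          [forall i : 'I_n, ~~ ((4 %| i.+1)%N && (0 < m i)%N)].
  apply/forallP/forallP => [H i|H k].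
    apply/negP => /andP[d4 mi].
    have /implyP := H (lift ord0 i); rewrite lift0 d4 => /(_ _)/negP[] //.
    by apply/existsP; exists i; rewrite eqxx.
  apply/implyP => /existsP[i /andP[/eqP <- mi]].
  by have := H i; rewrite mi andbT.
case: ifP => [/andP[/eqP sm /forallP al]|].
  rewrite (eq_bigr (fun i : 'I_n => 'X^(i.+1 * m i))); last first.
    by move=> i _; rewrite (negbTE (al i)).
  by rewrite -expr_sum sm coefXn eqxx.
have [/forallP al|/forallPn[i]] :=
  boolP [forall i : 'I_n, ~~ ((4 %| i.+1)%N && (0 < m i)%N)]; last first.
  by move/negPn => bad _; rewrite (bigD1 i) //= bad mul0r coef0.
rewrite andbT => sm.
rewrite (eq_bigr (fun i : 'I_n => 'X^(i.+1 * m i))); last first.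
  by move=> i _; rewrite (negbTE (al i)).
by rewrite -expr_sum coefXn eq_sym sm.
Qed.

Lemma euler_fourth n :
  \prod_(i < 4 * n | (4 %| i.+1)%N) (1 - 'X^(i.+1)) = euler n ('X^4 : {poly K}).
Proof.
rewrite -(big_mkord (fun i => (4 %| i.+1)%N) (fun i => 1 - 'X^(i.+1) : {poly K})) /euler.
elim: n => [|n IH]; first by rewrite big_ord0 big_geq.
rewrite big_ord_recr /= -IH (_ : 4 * n.+1 = (4 * n).+4)%N; last by lia.
rewrite !big_mkcond !big_nat_recr //=.
have -> : (4 %| (4 * n).+1)%N = false by lia.
have -> : (4 %| (4 * n).+2)%N = false by lia.
have -> : (4 %| (4 * n).+3)%N = false by lia.
have -> : (4 %| (4 * n).+4)%N = true by lia.
rewrite !mulr1 -exprM -big_mkcond; congr (_ * (1 - 'X^_)); lia.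
Qed.

(** Factor by factor, a geometric sum times [1 - 'X^(i.+1)] leaves 1 up to powers beyond ['X^n],
    while a part divisible by 4 leaves [1 - 'X^(i.+1)]. Raising the bound from [n] to [4 n] adds
    only factors congruent to 1. *)
Lemma gen4_euler n : eqX n.+1 (gen4 n * euler n 'X) (euler n 'X^4).
Proof.
rewrite /gen4 {1}/euler -big_split /=.
apply: (@eqX_trans _ _ (\prod_(i < n) (if (4 %| i.+1)%N then 1 - 'X^(i.+1) else 1))).
  apply: eqX_prod => i _; case: ifP => d4 /=.
    rewrite big_ord_recl /= muln0 expr0 big1 => [|j _]; last by [].
    by rewrite addr0 mul1r; exact: eqX_refl.
  under eq_bigr do rewrite exprM.
  have -> : (\sum_(j < n.+1) 'X^(i.+1) ^+ j) * (1 - 'X^(i.+1)) =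
            1 - ('X^(i.+1)) ^+ n.+1 :> {poly K}.
    by rewrite -[in RHS]opprB subrX1; ring.
  by rewrite /eqX addrC addKr dvdpNr -exprM dvdp_exp2l // mulSn leq_addr.
rewrite -big_mkcond -euler_fourth; apply: eqX_sym.
by apply: (euler_tail (fun i => 4 %| i.+1)%N); rewrite ?dvdpp // leq_pmull.
Qed.

End GeneratingFunction.

Section Morphisms.
Variables (R S : comNzRingType) (h : {rmorphism R -> S}).

Lemma rmorph_euler L x : h (euler L x) = euler L (h x).
Proof.
by rewrite rmorph_prod; apply: eq_bigr => i _; rewrite rmorphB rmorph1 rmorphXn.
Qed.

Lemma rmorph_phi L x : h (phi L x) = phi L (h x).
Proof.
rewrite rmorphD rmorph1 rmorphMn rmorph_sum.
by congr (_ + _ *+ 2); apply: eq_bigr => i _; rewrite rmorphXn.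
Qed.

Lemma rmorph_psi L x : h (psi L x) = psi L (h x).
Proof. by rewrite rmorph_sum; apply: eq_bigr => i _; rewrite rmorphXn. Qed.

End Morphisms.

(** * The Eisenstein theta series modulo 3 *)

Lemma triangular_sqr k : (8 * 'C(k.+1, 2) + 1 = k.*2.+1 ^ 2)%N.
Proof. by elim: k => // k IH; rewrite binS bin1; lia. Qed.

(** A cyclic group of order 3 acts without fixed points, so all orbits have size 3; the induction
    removes one orbit. *)
Lemma dvdn3_size (T : eqType) (f : T -> T) (s : seq T) : uniq s ->
  {in s, forall x, f x \in s} -> {in s, forall x, f (f (f x)) = x} ->
  {in s, forall x, f x != x} -> (3 %| size s)%N.
Proof.
have [m] := ubnP (size s); elim: m s => // m IH [|x s0] //.
set s := x :: s0 => le_m us fs f3 f1.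
have xs : x \in s by rewrite mem_head.
have fxs := fs _ xs; have ffxs := fs _ fxs.
pose o := [:: x; f x; f (f x)].
have uo : uniq o.
  have nfx := f1 _ xs; have nffx := f1 _ fxs; have nfffx := f1 _ ffxs; rewrite f3 // in nfffx.
  rewrite /= !inE (eq_sym x (f x)) (negbTE nfx) (negbTE nfffx).
  by rewrite (eq_sym (f x)) (negbTE nffx).
pose s2 := [seq y <- s | y \notin o].
have Es : perm_eq s (o ++ s2).
  apply: uniq_perm => //.
    rewrite cat_uniq uo filter_uniq // andbT; apply/hasPn => y.
    by rewrite mem_filter => /andP[].
  move=> y; rewrite mem_cat mem_filter; case: (boolP (y \in o)) => //= yo.
  by move: yo; rewrite !inE => /or3P[]/eqP->; rewrite -?[x == x]/true.
rewrite (perm_size Es) size_cat dvdn_addr //; apply: IH.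
- by move: le_m; rewrite (perm_size Es) size_cat /=; lia.
- exact: filter_uniq.
- move=> y; rewrite !mem_filter => /andP[yo ys]; rewrite fs // andbT.
  apply: contra yo; rewrite !inE => /or3P[]/eqP e.
  + by rewrite -(f3 y) // e eqxx !orbT.
  + by rewrite -(f3 y) // e f3 // eqxx.
  + by rewrite -(f3 y) // e f3 // eqxx orbT.
- by move=> y; rewrite mem_filter => /andP[_ /f3].
- by move=> y; rewrite mem_filter => /andP[_ /f1].
Qed.

Definition zball B : seq int :=
  [seq Posz i | i <- index_iota 0 B.+1] ++ [seq Negz i | i <- index_iota 0 B].

Lemma mem_zball B x : (x \in zball B) = (`|x| <= B)%N.
Proof.
rewrite mem_cat; apply/orP/idP => [[] /mapP[i]|].
- by rewrite mem_index_iota => ? ->; lia.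
- by rewrite mem_index_iota => ? ->; lia.
case: x => i le_iB; [left|right]; apply/mapP; exists i => //; rewrite mem_index_iota; lia.
Qed.

Lemma zball_uniq B : uniq (zball B).
Proof.
rewrite cat_uniq !map_inj_uniq ?iota_uniq ?andbT /=; try by move=> ? ? [].
by apply/hasPn => _ /mapP[i _ ->]; apply/negP => /mapP[].
Qed.

Lemma phi0 (R : comNzRingType) L : phi L (0 : R) = 1.
Proof. by rewrite /phi big1 ?mul0rn ?addr0 // => i _; rewrite expr0n. Qed.

Lemma sum_zball (V : zmodType) B (G : int -> V) :
  \sum_(x <- zball B) G x = G 0 + \sum_(i < B) (G (i.+1)%:Z + G (- (i.+1)%:Z)).
Proof.
rewrite big_cat !big_map !big_mkord big_ord_recl /= -addrA; congr (_ + _).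
by rewrite big_split.
Qed.

Lemma sqr_absz (x : int) : x * x = (`|x| ^ 2)%N.
Proof. by rewrite PoszM abszE -normrM ger0_norm // -expr2 sqr_ge0. Qed.

Lemma phi_zball (R : comNzRingType) L (x : R) :
  phi L x = \sum_(u <- zball L) x ^+ (`|u| ^ 2).
Proof.
by rewrite sum_zball /phi expr0 -sumrMnl; congr (_ + _); apply: eq_bigr.
Qed.

Section EisensteinTheta.
Variable K : fieldType.

Lemma sum_zball_parity L (G : int -> K) :
  \sum_(x <- zball L.*2.+1) G x = \sum_(u <- zball L) G (2 * u) +
    \sum_(k < L.+1) (G (k.*2.+1)%:Z + G (- (k.*2.+1)%:Z)).
Proof.
rewrite !sum_zball mulr0 -addrA; congr (_ + _).
elim: L => [|L IH]; first by rewrite !big_ord_recr !big_ord0 /= !add0r.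
rewrite doubleS 2!big_ord_recr /= {}IH [in RHS]big_ord_recr [in X in _ = _ + X]big_ord_recr /=.
rewrite -doubleS mulrN (_ : 2 * L.+1%:Z = L.+1.*2%:Z); last by lia.
by rewrite -addrA addrACA !addrA.
Qed.

Hypothesis char3 : 3%:R = 0 :> K.

(** For [N = 4 n] the solutions are the Eisenstein integers [(x + y sqrt -3) / 2] of norm [n]. *)
Definition rep13 N (x y : int) : bool := x * x + 3 * (y * y) == N%:Z.

Lemma rep13_mod3 L n : (0 < n <= L)%N ->
  \sum_(x <- zball L.*2.+1) \sum_(y <- zball L.*2.+1) (rep13 (4 * n) x y)%:R = 0 :> K.
Proof.
move=> /andP[n0 nL]; set B := L.*2.+1.
pose s := [seq p <- [seq (x, y) | x <- zball B, y <- zball B] | rep13 (4 * n) p.1 p.2].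
transitivity ((size s)%:R : K).
  rewrite -sum1_size natr_sum big_filter [RHS]big_mkcond [RHS]big_allpairs.
  by apply: eq_bigr => x _; apply: eq_bigr => y _ /=; case: rep13.
have mem_s (x y : int) : ((x, y) \in s) = rep13 (4 * n) x y.
  rewrite mem_filter andbC; case: (boolP (rep13 _ _ _)) => [e0|]; last by rewrite andbF.
  have e : x * x + 3 * (y * y) = (4 * n)%:Z by exact/eqP/e0.
  rewrite andbT; apply/allpairsP; exists (x, y); rewrite !mem_zball /B.
  (* No solution lies outside the ball: its coordinates have squares at most
     [4 n <= 4 L < (2 L + 2) ^ 2]. *)
  have bound (z : int) : z * z <= (4 * n)%:Z -> (`|z| <= L.*2.+1)%N.
    have -> : z * z = (`|z| * `|z|)%N by rewrite PoszM abszE -normrM ger0_norm // -expr2 sqr_ge0.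
    by move: `|z|%N => m mn; rewrite leqNgt; apply/negP => ltm; have := leq_mul ltm ltm; nia.
  have := sqr_ge0 x; have := sqr_ge0 y; rewrite !expr2 => yy xx.
  by split=> //=; apply: bound; lia.
(* Modulo 4 the form vanishes only when [x] and [y] have the same parity. *)
have even_rep (x y : int) : rep13 (4 * n) x y -> exists t, x = y + 2 * t.
  move/eqP; have [a [->|->]] : exists a, x = 2 * a \/ x = 2 * a + 1.
  - by exists (x %/ 2)%Z; lia.
  - have [b [->|->]] : exists b, y = 2 * b \/ y = 2 * b + 1.
    + by exists (y %/ 2)%Z; lia.
    + by exists (a - b); ring.
    + lia.
  have [b [->|->]] : exists b, y = 2 * b \/ y = 2 * b + 1.
  - by exists (y %/ 2)%Z; lia.
  - lia.
  - by exists (a - b); ring.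
suff /dvdnP[m ->] : (3 %| size s)%N by rewrite natrM char3 mulr0.
(* Writing elements as (x + y sqrt -3) / 2, this is multiplication by the cube
   root of unity (-1 + sqrt -3) / 2. *)
pose sg (p : int * int) := let t := ((p.1 - p.2) %/ 2)%Z in (- (2 * p.2) - t, t).
have sgE y t : sg (y + 2 * t, y) = (- (2 * y) - t, t).
  by rewrite /sg /=; have -> : ((y + 2 * t - y) %/ 2)%Z = t by lia.
apply: (@dvdn3_size _ sg).
- rewrite filter_uniq // allpairs_uniq ?zball_uniq //.
  by move=> [? ?] [? ?] _ _ [-> ->].
- move=> [x y]; rewrite mem_s => r; have [t e] := even_rep _ _ r.
  by move: r; rewrite e sgE mem_s /rep13 => /eqP <-; apply/eqP; ring.
- move=> [x y]; rewrite mem_s => /even_rep[t ->]; rewrite sgE.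
  rewrite (_ : - (2 * y) - t = t + 2 * (- y - t)); last by ring.
  rewrite sgE (_ : - (2 * t) - _ = (- y - t) + 2 * y); last by ring.
  by rewrite sgE; congr (_, _); ring.
- move=> [x y]; rewrite mem_s => r; have [t e] := even_rep _ _ r.
  (* A fixed point satisfies [t = y] and [3 y + 3 t = 0], hence is the origin, contradicting
     [n > 0]. *)
  rewrite e sgE; apply/eqP => -[e1 e2]; move: r; rewrite e /rep13 => /eqP; nia.
Qed.

Lemma coef_phi_phi3 L n : (phi L 'X * phi L 'X^3 : {poly K})`_n =
  \sum_(u <- zball L) \sum_(v <- zball L) (rep13 n u v)%:R.
Proof.
rewrite !phi_zball big_distrlr coef_sum; apply: eq_bigr => u _.
rewrite coef_sum; apply: eq_bigr => v _.
rewrite /= -exprM -exprD coefXn /rep13 !sqr_absz; congr (_%:R); congr nat_of_bool; lia.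
Qed.

Lemma sum_ord_supp (G : nat -> K) a b : (a <= b)%N ->
  (forall k, (a <= k)%N -> G k = 0) -> \sum_(k < b) G k = \sum_(k < a) G k.
Proof.
move=> ab Ga; rewrite -!(big_mkord xpredT G) (big_cat_nat (leq0n a) ab) /=.
by rewrite [X in _ + X]big_nat [X in _ + X]big1 ?addr0 // => k /andP[/Ga].
Qed.

(** Completing squares, four times the exponent [1 + k (k + 1) + 3 j (j + 1)] is
    [(2 k + 1) ^ 2 + 3 (2 j + 1) ^ 2]. *)
Lemma coef_psi_psi3 L n : (0 < L)%N -> (n <= L)%N ->
  ('X * psi L 'X^2 * psi L 'X^6 : {poly K})`_n =
  \sum_(k < L.+1) \sum_(j < L.+1) (rep13 (4 * n) k.*2.+1 j.*2.+1)%:R.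
Proof.
move=> L0 nL.
have term k j : ('X * 'X^2 ^+ 'C(k.+1, 2) * 'X^6 ^+ 'C(j.+1, 2) : {poly K})`_n =
    (rep13 (4 * n) k.*2.+1 j.*2.+1)%:R.
  rewrite -!exprM -exprS -exprD coefXn /rep13 !sqr_absz /= -!triangular_sqr.
  by congr (_%:R); congr nat_of_bool; lia.
have big k j : (L < k)%N || (L < j)%N -> rep13 (4 * n) k.*2.+1 j.*2.+1 = false.
  by rewrite /rep13 => kj; apply/negP => /eqP; nia.
have le2 : (L.+1 <= L.*2)%N by lia.
rewrite /psi -mulrA big_distrlr mulr_sumr coef_sum.
under eq_bigr => k _ do rewrite mulr_sumr coef_sum.
under eq_bigr => k _ do under eq_bigr => j _ do rewrite mulrA term.
pose G k j : K := (rep13 (4 * n) (k.*2.+1)%:Z (j.*2.+1)%:Z)%:R.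
rewrite (@sum_ord_supp (fun k => \sum_(j < L.*2) G k j) _ _ le2) => [|k Lk]; last first.
  by rewrite big1 // => j _; rewrite /G big ?Lk.
apply: eq_bigr => k _; rewrite (@sum_ord_supp (G k) _ _ le2) // => j Lj.
by rewrite /G big // Lj orbT.
Qed.

(** For a positive exponent [n], split the solutions of [x ^ 2 + 3 y ^ 2 = 4 n] by parity: even
    pairs give the first product, odd pairs the second, and mixed pairs do not occur. *)
Lemma phi_psi_mod3 L : (0 < L)%N -> eqX L.+1
  (phi L 'X * phi L 'X^3 + 'X * psi L 'X^2 * psi L 'X^6) (1 : {poly K}).
Proof.
move=> L0; apply: eqX_from_coef => -[_|n].
  rewrite -!horner_coef0 hornerD !hornerM hornerX !mul0r addr0 hornerC.
  rewrite -2![(phi _ _).[0]]/(horner_eval 0 _) !rmorph_phi /= /horner_eval !hornerE /=.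
  by rewrite expr0n /= phi0 mul1r.
rewrite ltnS coefD coef1 => nL; rewrite coef_phi_phi3 coef_psi_psi3 //.
set N := (4 * n.+1)%N.
have := @rep13_mod3 L n.+1 nL; rewrite sum_zball_parity -/N => eq0; rewrite -[RHS]eq0.
congr (_ + _).
  apply: eq_bigr => u _; rewrite sum_zball_parity [X in _ = _ + X]big1 ?addr0.
    by apply: eq_bigr => v _; congr (_%:R); congr nat_of_bool; rewrite /rep13 /N; lia.
  move=> j _; rewrite /rep13 /N; do 2?[case: eqP => [e|_]]; rewrite ?addr0 //; exfalso; lia.
apply: eq_bigr => k _; rewrite !sum_zball_parity.
have odd_even (x v : int) : `|x|%N = k.*2.+1 -> (rep13 N x (2 * v))%:R = 0 :> K.
  move=> xk; rewrite /rep13 /N sqr_absz xk; case: eqP => // e; exfalso; nia.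
rewrite [X in _ = X + _ + _]big1 => [|v _]; last by rewrite odd_even.
rewrite [X in _ = _ + (X + _)]big1 => [|v _]; last by rewrite odd_even // abszN.
rewrite !add0r -big_split; apply: eq_bigr => j _ /=; rewrite /rep13 !mulrNN.
set r : K := (_ == _)%:R.
(* The four sign choices of an odd pair count once modulo 3. *)
have -> : r + r + (r + r) = r + 3%:R * r by ring.
by rewrite char3 mul0r addr0.
Qed.

End EisensteinTheta.

(** * Three-dissection *)

Lemma sqr_mod3 m : (m ^ 2 %% 3 = (m %% 3 != 0))%N.
Proof.
by rewrite -modnXm; have := ltn_pmod m (isT : 0 < 3)%N; case: (m %% 3)%N => [|[|[|]]].
Qed.

Section Dissection.
Variable K : fieldType.
Implicit Types p s d : {poly K}.

Definition avoids r p := forall i, (i %% 3)%N = r -> p`_i = 0.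

Lemma avoidsM r p d : avoids r p -> avoids r (p * (d \Po 'X^3)).
Proof.
move=> pr i ir; rewrite coefM big1 // => -[j /= lt_ji] _.
rewrite coef_comp_poly_Xn //; case: ifP => d3; last by rewrite mulr0.
by rewrite pr ?mul0r //; lia.
Qed.

Lemma avoids_div M r p s d : d`_0 != 0 -> eqX M (p * (d \Po 'X^3)) s ->
  avoids r s -> forall i, (i < M)%N -> (i %% 3)%N = r -> p`_i = 0.
Proof.
move=> d0 eqps sr; elim/ltn_ind => i IH ltiM ir.
have := eqX_coef eqps ltiM; rewrite (sr i ir) coefM big_ord_recr /= subnn.
rewrite coef_comp_poly_Xn //= div0n big1 => [/eqP|[j /= lt_ji] _].
  by rewrite add0r mulf_eq0 (negbTE d0) orbF => /eqP.
rewrite coef_comp_poly_Xn //; case: ifP => d3; last by rewrite mulr0.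
by rewrite IH ?mul0r //; lia.
Qed.

(** An exponent [e] has [8 e - 7] an odd square; if 3 divided [e], this square would be 2 modulo
    3. *)
Lemma avoids0_psi L : avoids 0 ('X * psi L 'X).
Proof.
move=> i i0; rewrite /psi mulr_sumr coef_sum big1 // => k _.
rewrite -exprS coefXn; case: eqP => // ik; exfalso.
by have := triangular_sqr k; have := sqr_mod3 k.*2.+1; case: eqP => _ /=; lia.
Qed.

(** Exponents are [2 m ^ 2], which is 0 or 2 modulo 3. *)
Lemma avoids1_phi L : avoids 1 (phi L (- 'X^2)).
Proof.
move=> i i1; rewrite /phi coefD coefMn coef_sum coef1 big1 => [|k _].
  by rewrite mul0rn addr0; case: i i1.
have k3 : (k.+1 ^ 2 %% 3 != 2)%N by rewrite sqr_mod3; case: (k.+1 %% 3 == 0)%N.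
rewrite exprNn -exprM -signr_odd; case: (odd _); rewrite ?mulN1r ?mul1r ?coefN coefXn;
  by case: eqP => [ik|_]; rewrite ?oppr0 //; exfalso; lia.
Qed.

Hypothesis char3 : 3%:R = 0 :> K.

Lemma euler_cube L (x : {poly K}) : euler L x ^+ 3 = euler L (x ^+ 3).
Proof.
rewrite /euler -prodrXl; apply: eq_bigr => i _; rewrite exprAC.
set y := x ^+ _; have -> : (1 - y) ^+ 3 = 1 - y ^+ 3 + 3%:R * (y ^+ 2 - y) by ring.
by rewrite -polyC_natr char3 mul0r addr0.
Qed.

(** The substitution [q -> -q] changes the modulus ['X^(L+1)] by a sign at most. *)
Lemma phi_psiN_mod3 L : (0 < L)%N ->
   eqX L.+1 (phi L (- 'X) * phi L (- 'X^3) - 'X * psi L ('X^2) * psi L ('X^6)) (1 : {poly K}).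
Proof.
move=> /(phi_psi_mod3 char3)/dvdpP[r /(congr1 (comp_poly (- 'X)))].
rewrite rmorphB rmorph1 rmorphD !rmorphM /= !rmorph_phi !rmorph_psi /=.
rewrite !rmorphXn /= !comp_polyX ![(- 'X) ^+ _]exprNn.
rewrite -!(signr_odd _ 3) -!(signr_odd _ 2) -!(signr_odd _ 6) /= !expr1 !expr0 !mul1r mulN1r => E.
rewrite /eqX !mulNr in E *; rewrite E dvdp_mull // dvdp_mull //.
Qed.

Section Level.
Variables (L : nat) (L0 : (0 < L)%N).
Notation F := (gen4 K L).
Notation f k := (euler L ('X^k : {poly K})).

Let fX0 k : (f k.+1)`_0 != 0.
Proof. by rewrite euler_coef0 // exprS dvdp_mulr. Qed.

Let hF : eqX L.+1 (F * f 1) (f 4). Proof. exact: gen4_euler. Qed.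
Let hphiN : eqX L.+1 (phi L (- 'X) * f 2) (f 1 ^+ 2).
Proof. exact/phi_euler/dvdpp. Qed.
Let hphi : eqX L.+1 (phi L 'X * f 2) (euler L (- 'X) ^+ 2).
Proof. by have := @phi_euler K L (- 'X); rewrite opprK sqrrN; apply; rewrite dvdpNr. Qed.
Let hphi2 : eqX L.+1 (phi L (- 'X^2) * f 4) (f 2 ^+ 2).
Proof. by have := @phi_euler K L 'X^2; rewrite -exprM; apply; rewrite dvdp_mulr. Qed.
Let hpsi : eqX L.+1 (psi L 'X * f 1) (f 2 ^+ 2).
Proof. exact/psi_euler/dvdpp. Qed.
Let hpsiN : eqX L.+1 (psi L (- 'X) * euler L (- 'X)) (f 2 ^+ 2).
Proof. by have := @psi_euler K L (- 'X); rewrite sqrrN; apply; rewrite // dvdpNr. Qed.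
Let hpsi2 : eqX L.+1 (psi L 'X^2 * f 2) (f 4 ^+ 2).
Proof. by have := @psi_euler K L 'X^2; rewrite -exprM; apply; rewrite // dvdp_mulr. Qed.
Let hg : eqX L.+1 (euler L (- 'X) * f 1 * f 4) (f 2 ^+ 3).
Proof. exact/eulerN/dvdpp. Qed.

(** Both sides are [f_1 f_4 / f_2], since [f_1(-q) = f_2^3 / (f_1 f_4)]. *)
Lemma gen4_phiN : eqX L.+1 (F * phi L (- 'X)) (psi L (- 'X)).
Proof.
apply: (@eqX_cancel _ _ (f 1 * f 2 ^+ 3)).
  by rewrite -horner_coef0 hornerM horner_exp !horner_coef0 mulf_neq0 ?expf_neq0.
move: hF hphiN hpsiN hg; rewrite /eqX.
set g := euler L (- 'X); set f1 := f 1; set f2 := f 2; set f4 := f 4.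
set p := phi _ _; set s := psi _ _ => h1 h2 h3 h4.
have -> : f1 * f2 ^+ 3 * (F * p) - f1 * f2 ^+ 3 * s =
  p * f2 ^+ 3 * (F * f1 - f4) + f4 * f2 ^+ 2 * (p * f2 - f1 ^+ 2) +
  (s * f1) * (g * f1 * f4 - f2 ^+ 3) - f1 ^+ 2 * f4 * (s * g - f2 ^+ 2) by ring.
by rewrite dvdp_sub ?dvdp_add ?dvdp_mull.
Qed.

(** Both sides are [f_2^2 f_4^3 / f_1]. The extra factors are cubes, which are series in [q^3]
    modulo 3. *)
Lemma gen4_psi2 : eqX L.+1 (F * psi L 'X^2 * f 2 ^+ 3) (f 4 ^+ 3 * psi L 'X).
Proof.
apply: (@eqX_cancel _ _ (f 1)) => //.
move: hF hpsi hpsi2; rewrite /eqX.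
set f1 := f 1; set f2 := f 2; set f4 := f 4.
set s := psi _ _; set s2 := psi _ _ => h1 h2 h3.
have -> : f1 * (F * s2 * f2 ^+ 3) - f1 * (f4 ^+ 3 * s) =
  s2 * f2 ^+ 3 * (F * f1 - f4) + f4 * f2 ^+ 2 * (s2 * f2 - f4 ^+ 2) -
  f4 ^+ 3 * (s * f1 - f2 ^+ 2) by ring.
by rewrite dvdp_sub ?dvdp_add ?dvdp_mull.
Qed.

(** As [phi(q) = f_2^5 / (f_1^2 f_4^2)], both sides are [f_2^5 / f_4]. *)
Lemma gen4_phi : eqX L.+1 (F * phi L 'X * f 1 ^+ 3) (f 2 ^+ 3 * phi L (- 'X^2)).
Proof.
apply: (@eqX_cancel _ _ (f 2 * f 4 ^+ 2)).
  by rewrite -horner_coef0 hornerM horner_exp !horner_coef0 mulf_neq0 ?expf_neq0.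
move: hF hphi hphi2 hg; rewrite /eqX.
set g := euler L (- 'X); set f1 := f 1; set f2 := f 2; set f4 := f 4.
set p := phi _ _; set p2 := phi _ _ => h1 h2 h3 h4.
have -> : f2 * f4 ^+ 2 * (F * p * f1 ^+ 3) - f2 * f4 ^+ 2 * (f2 ^+ 3 * p2) =
  p * f2 * f1 ^+ 2 * f4 ^+ 2 * (F * f1 - f4) +
  f4 ^+ 3 * f1 ^+ 2 * (p * f2 - g ^+ 2) +
  f4 * (g * f1 * f4 + f2 ^+ 3) * (g * f1 * f4 - f2 ^+ 3) -
  f2 ^+ 4 * f4 * (p2 * f4 - f2 ^+ 2) by ring.
by rewrite dvdp_sub ?dvdp_add ?dvdp_mull.
Qed.

(** Here [A(q^3) = f_4^3 psi(q^6) / f_2^3]; the denominator is cleared by [f_2^3] and removed again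
    by [avoids_div]. *)
Lemma gen4_part0 i : (i <= L)%N -> (i %% 3)%N = 0%N ->
  F`_i = (psi L (- 'X) * phi L (- 'X^3))`_i.
Proof.
move=> leiL i0; apply/eqP; rewrite -subr_eq0 -coefB; apply/eqP.
have sup : avoids 0 (- ('X * psi L 'X * ((euler L 'X^4 * psi L 'X^2) \Po 'X^3 : {poly K}))).
  by move=> k k0; rewrite coefN (avoidsM _ (@avoids0_psi L)) ?oppr0.
apply: (avoids_div (M := L.+1) (fX0 1) _ sup) => //.
rewrite rmorphM /= !rmorph_euler rmorph_psi /= !rmorphXn /= !comp_polyX ?comp_polyXn.
rewrite !(exprAC _ 3) -!euler_cube -exprM.
move: gen4_phiN gen4_psi2 (phi_psiN_mod3 L0); rewrite /eqX.
set f2 := f 2; set f4 := f 4; set sN := psi L (- 'X); set s2 := psi L 'X^2; set s := psi L 'X.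
set s6 := psi L 'X^6; set pN := phi L (- 'X); set p3 := phi _ _ => h1 h2 h3.
have -> : (F - sN * p3) * f2 ^+ 3 - - ('X * s * (f4 ^+ 3 * s6)) =
   f2 ^+ 3 * p3 * (F * pN - sN) - 'X * s6 * (F * s2 * f2 ^+ 3 - f4 ^+ 3 * s)
   - F * f2 ^+ 3 * (pN * p3 - 'X * s2 * s6 - 1) by ring.
by do 2?[apply: dvdp_sub]; apply: dvdp_mull.
Qed.

(** Adding the two theta identities cancels the [psi] products and leaves 2, which is -1 modulo 3.
    Here [B(q^3) = f_2^3 phi(q^3) / f_1^3]. *)
Lemma gen4_part1 i : (i <= L)%N -> (i %% 3)%N = 1%N ->
  F`_i = - (psi L (- 'X) * phi L (- 'X^3))`_i.
Proof.
move=> leiL i0; apply/eqP; rewrite -addr_eq0 -coefD; apply/eqP.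
have sup : avoids 1 (- (phi L (- 'X^2) * ((phi L 'X * euler L 'X^2) \Po 'X^3 : {poly K}))).
  by move=> k k0; rewrite coefN (avoidsM _ (@avoids1_phi L)) ?oppr0.
apply: (avoids_div (M := L.+1) (fX0 0) _ sup) => //.
rewrite rmorphM /= !rmorph_euler rmorph_phi /= !rmorphXn /= !comp_polyX ?comp_polyXn.
rewrite !(exprAC _ 3) -!euler_cube.
move: gen4_phiN gen4_phi (phi_psi_mod3 char3 L0) (phi_psiN_mod3 L0); rewrite /eqX.
set f2 := f 2; set f1 := f 1; set sN := psi L (- 'X); set s2 := psi L 'X^2.
set s6 := psi L 'X^6; set pN := phi L (- 'X); set p3 := phi L (- 'X^3).
set p := phi L 'X; set p2 := phi L (- 'X^2); set q3 := phi L 'X^3 => h1 h2 h3 h4.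
have c3 : 3%:R = 0 :> {poly K} by rewrite -polyC_natr char3.
have -> : (F + sN * p3) * f1 ^+ 3 - - (p2 * (q3 * f2 ^+ 3)) =
   F * f1 ^+ 3 * ((p * q3 + 'X * s2 * s6 - 1) + (pN * p3 - 'X * s2 * s6 - 1)) -
   q3 * (F * p * f1 ^+ 3 - f2 ^+ 3 * p2) - f1 ^+ 3 * p3 * (F * pN - sN)
   + 3%:R * (F * f1 ^+ 3) by ring.
rewrite c3 mul0r addr0.
by do 2?[apply: dvdp_sub]; apply: dvdp_mull => //; apply: dvdp_add.
Qed.

End Level.
End Dissection.

(** * Primes inert in Q(sqrt -6) *)

Section Inert.
Local Open Scope nat_scope.

Lemma sqrt_floor n : exists s, s ^ 2 <= n < s.+1 ^ 2.
Proof.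
elim: n => [|n [s sn]]; first by exists 0.
by have [ls|ls] := ltnP n.+1 (s.+1 ^ 2); [exists s | exists s.+1]; lia.
Qed.

Lemma sqr_mod24 a : a ^ 2 %% 24 \in [:: 0; 1; 4; 9; 12; 16].
Proof.
have /allP sq : all (fun r => r ^ 2 %% 24 \in [:: 0; 1; 4; 9; 12; 16]) (iota 0 24) by [].
by rewrite -modnXm; apply: sq; rewrite mem_iota ltn_pmod.
Qed.

Variables (l : nat) (hl : prime l) (hmod : l %% 24 \in [:: 13; 17; 19; 23]).

(** This form and the one in [norm23_neq] are the reduced forms of discriminant -24; both miss the
    four classes modulo 24. *)
Lemma norm6_neq a b : a ^ 2 + 6 * b ^ 2 <> l.
Proof.
by have := sqr_mod24 a; have := sqr_mod24 b; move: hmod; rewrite !inE; lia.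
Qed.

Lemma norm23_neq a b : 2 * a ^ 2 + 3 * b ^ 2 <> l.
Proof.
by have := sqr_mod24 a; have := sqr_mod24 b; move: hmod; rewrite !inE; lia.
Qed.

(** For [k = 2, 3], dividing out [k] leads to [2 a ^ 2 + 3 b ^ 2 = l]; for [k = 4, 6], two divisions
    lead back to [k = 1]. Multiplication by 5 permutes the four classes modulo 24. *)
Lemma norm6_multiple k a b : 0 < k < 7 -> a ^ 2 + 6 * b ^ 2 <> k * l.
Proof.
have dvd_sqr p c : prime p -> p %| c ^ 2 -> exists d, c = p * d.
  by move=> pp; rewrite Euclid_dvdX // andbT => /dvdnP[d ->]; exists d; rewrite mulnC.
have ev c m : c ^ 2 = 2 * m -> exists d, c = 2 * d.
  by move=> e; apply: dvd_sqr => //; rewrite e dvdn_mulr.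
have tr c m : c ^ 2 = 3 * m -> exists d, c = 3 * d.
  by move=> e; apply: dvd_sqr => //; rewrite e dvdn_mulr.
case: k => [|[|[|[|[|[|[|//]]]]]]] // _ e.
- by apply: (@norm6_neq a b); lia.
- have [|c ec] := ev a (l - 3 * b ^ 2); first by lia.
  by apply: (@norm23_neq c b); rewrite ec in e; lia.
- have [|c ec] := tr a (l - 2 * b ^ 2); first by lia.
  by apply: (@norm23_neq b c); rewrite ec in e; lia.
- have [|c ec] := ev a (2 * l - 3 * b ^ 2); first by lia.
  have [|d ed] := ev b (l - c ^ 2 - b ^ 2); first by rewrite ec in e; lia.
  by apply: (@norm6_neq c d); rewrite ec ed in e; lia.
- by have := sqr_mod24 a; have := sqr_mod24 b; move: hmod; rewrite !inE; lia.
- have [|c ec] := ev a (3 * (l - b ^ 2)); first by lia.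
  have [|d ed] := tr c (c ^ 2 + b ^ 2 - l); first by rewrite ec in e; lia.
  by apply: (@norm6_neq b d); rewrite ec ed in e; lia.
Qed.

(* Thue's lemma: a zero of x^2 + 6 y^2 modulo l off the origin yields a multiple
   of l below 7 l represented by the form. *)
Lemma norm6_inert x y : l %| x ^ 2 + 6 * y ^ 2 -> l %| y.
Proof.
move=> lxy; apply/negPn/negP => ly.
have [s /andP[sl ls]] := sqrt_floor l.
have ltsl : s ^ 2 < l.
  rewrite ltn_neqAle sl andbT; apply/eqP => e; have l1 := prime_gt1 hl.
  have /primeP[_ /(_ s)] := hl; rewrite -[X in s %| X]e dvdn_exp // => /(_ isT).
  by case/orP => /eqP es; nia.
(* There are [(s + 1) ^ 2 > l] pairs, so two of them collide. *)
pose f (p : 'I_s.+1 * 'I_s.+1) : 'F_l := (p.1%:R * y%:R - p.2%:R * x%:R)%R.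
have : ~~ injectiveb f.
  apply/negP => /injectiveP/leq_card; rewrite card_prod card_Fp // !card_ord.
  by rewrite leqNgt mulnn ls.
case/injectivePn => -[i j] [[i' j'] neq ef].
(* Absolute differences stay in the naturals, and only their squares matter. *)
have diff (u v : 'I_s.+1) : exists a,
    [/\ a <= s, (a%:R ^+ 2 = (u%:R - v%:R) ^+ 2 :> 'F_l)%R & a = 0 -> u = v].
  have [us vs] := (ltn_ord u, ltn_ord v).
  case: (leqP v u) => uv.
    exists (u - v); split; [lia | by rewrite natrB | by move=> e; apply: val_inj => /=; lia].
  exists (v - u); split; [lia | rewrite natrB ?(ltnW uv) //; ring | lia].
have [a [as_ ea a0]] := diff i i'; have [b [bs eb b0]] := diff j j'.
have Fl0 m : ((m%:R : 'F_l) == 0)%R = (l %| m) by rewrite -(dvdn_pcharf (pchar_Fp hl)).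
have : l %| a ^ 2 + 6 * b ^ 2.
  have : ((a ^ 2 + 6 * b ^ 2)%:R * y%:R ^+ 2 == 0 :> 'F_l)%R.
    rewrite natrD natrM !natrX ea eb.
    move: lxy; rewrite -Fl0 natrD natrM !natrX => /eqP xy0.
    move: ef; rewrite /f /= => ef.
    have e : ((i%:R - i'%:R) * y%:R = (j%:R - j'%:R) * x%:R :> 'F_l)%R.
      transitivity ((i%:R * y%:R - j%:R * x%:R) - (i'%:R * y%:R - j'%:R * x%:R)
         + (j%:R - j'%:R) * x%:R : 'F_l)%R; first by ring.
      by rewrite ef subrr add0r.
    rewrite mulrDl -exprMn e; apply/eqP.
    transitivity ((j%:R - j'%:R) ^+ 2 * (x%:R ^+ 2 + 6%:R * y%:R ^+ 2) : 'F_l)%R; first by ring.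
    by rewrite xy0 mulr0.
  by rewrite mulf_eq0 expf_eq0 /= !Fl0 (negbTE ly) orbF.
case/dvdnP => k ek; apply: (@norm6_multiple k a b _ ek).
have l0 := prime_gt0 hl.
(* [k > 0] because the colliding pairs differ; [k < 7] because
   [a ^ 2 + 6 b ^ 2 <= 7 s ^ 2 < 7 l]. *)
apply/andP; split.
  rewrite lt0n; apply: contra neq => /eqP k0; move: ek; rewrite k0 mul0n => ek.
  by rewrite a0 ?b0 //; lia.
rewrite -(ltn_pmul2r l0) -ek.
have := leq_mul as_ as_; have := leq_mul bs bs; rewrite !mulnn; lia.
Qed.

(** Once [l] divides [y] it divides [x] too, so both terms are divisible by [l ^ 2]. *)
Lemma norm6_inert_sqr x y : l %| x ^ 2 + 6 * y ^ 2 -> l ^ 2 %| x ^ 2 + 6 * y ^ 2.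
Proof.
move=> lxy; have ly := norm6_inert lxy; move: lxy.
have ly2 : l ^ 2 %| 6 * y ^ 2 by rewrite dvdn_mull // dvdn_exp2r.
rewrite dvdn_addl; last by apply: dvdn_trans ly2; rewrite dvdn_exp.
by rewrite Euclid_dvdX // andbT => lx; rewrite dvdn_add // dvdn_exp2r.
Qed.

End Inert.

(** * Vanishing coefficients and the congruences *)

Lemma coef_psi_phi_eq0 (K : fieldType) L n :
  (forall x y, 8 * n + 1 != x ^ 2 + 6 * y ^ 2)%N ->
  (psi L (- 'X) * phi L (- 'X^3) : {poly K})`_n = 0.
Proof.
move=> no; rewrite phi_zball /psi big_distrlr coef_sum big1 // => k _.
rewrite coef_sum big1 // => u _ /=.
rewrite (exprNn 'X) (exprNn 'X^3) mulrACA -exprD -exprM -exprD -signr_odd.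
have /negbTE ne : n != ('C(k.+1, 2) + 3 * `|u| ^ 2)%N.
  (* For [n = k (k + 1) / 2 + 3 u ^ 2] one has [8 n + 1 = (2 k + 1) ^ 2 + 6 (2 u) ^ 2]. *)
  apply: contra (no k.*2.+1 (2 * `|u|)%N) => /eqP ->.
  by rewrite -triangular_sqr; apply/eqP; lia.
by case: (odd _); rewrite ?mulN1r ?mul1r ?coefN coefXn ne ?oppr0.
Qed.

Lemma b4_dvd3 N : (0 < N)%N -> (N %% 3 < 2)%N ->
  (forall x y, 8 * N + 1 != x ^ 2 + 6 * y ^ 2)%N -> (3 %| b4 N)%N.
Proof.
move=> N0 N3 no; have char3 : 3%:R = 0 :> 'F_3 by apply/val_inj.
rewrite (dvdn_pcharf (pchar_Fp (isT : prime 3))) -coef_gen4.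
case: (ltngtP (N %% 3)%N 1%N) => [N0'|N1|N1].
- by rewrite (gen4_part0 char3) ?coef_psi_phi_eq0 //; lia.
- by move: N3; rewrite ltnNge N1.
- by rewrite (gen4_part1 char3) ?coef_psi_phi_eq0 ?oppr0.
Qed.

Local Close Scope ring_scope.

Theorem theorem1p2 (l : nat) (hl : prime l)
    (hmod : l %% 24 \in [:: 13; 17; 19; 23]) (n j : nat)
    (hj : 1 <= j <= l - 1) :
  b4 (3 * l * (l * n + j) + (l ^ 2 - 1) %/ 8) = 0 %[mod 3] /\
  b4 (3 * l * (l * n + j) + (9 * l ^ 2 - 1) %/ 8) = 0 %[mod 3].
Proof.
have no N m : (8 * N + 1 = l * m) -> ~~ (l %| m) ->
    forall x y, (8 * N + 1 != x ^ 2 + 6 * y ^ 2).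
  move=> eN lm x y; apply: contra lm => /eqP exy.
  have := @norm6_inert_sqr l hl hmod x y; rewrite -exy eN dvdn_mulr // => /(_ isT).
  by rewrite expnS expn1 dvdn_pmul2l // prime_gt0.
have l24n : ~~ (l %| 24).
  rewrite (_ : 24 = 2 ^ 3 * 3) // Euclid_dvdM // Euclid_dvdX // andbT.
  by apply/negP => /orP[]/dvdn_leq-/(_ isT); move: hmod; rewrite !inE; lia.
have lj : ~~ (l %| 24 * j).
  rewrite Euclid_dvdM // negb_or l24n /=; apply/negP => /dvdn_leq; lia.
(* Hence [(l ^ 2 - 1) / 8] is 0 and [(9 l ^ 2 - 1) / 8] is 1 modulo 3, the two residues that
   [b4_dvd3] covers. *)
have l24 : (l ^ 2 %% 24 = 1).
  by rewrite -modnXm; move: hmod; rewrite !inE => /or4P[]/eqP->.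
split; apply/eqP; rewrite mod0n -/(dvdn _ _).
  apply: b4_dvd3; try lia.
  (* [8 N + 1 = l ^ 2 + 24 l (l n + j)]; the cofactor of [l] is [24 j] modulo [l], hence prime to
     [l]. *)
  apply: (no _ (l + 24 * (l * n + j))); first by lia.
  by rewrite dvdn_addr // mulnDr dvdn_addr // mulnCA dvdn_mulr.
apply: b4_dvd3; try lia.
apply: (no _ (9 * l + 24 * (l * n + j))); first by lia.
rewrite dvdn_addr; last exact: dvdn_mull.
by rewrite mulnDr dvdn_addr // mulnCA dvdn_mulr.
Qed.
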